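(* Let $n\in\mathbb N$ and let $\varphi_{(n)}$ be a multiple test procedure for $H_1,\dots,H_n$ defined in terms of critical values $\alpha_{i:n}=\rho(i/n)$, $i=1,\dots,n$. Let $\vartheta\in\Theta$ be such that $n_0\in\mathbb N_n$ of the hypotheses $H_1,\dots,H_n$ are true and the remaining ones are false. Let $I_0=I_0(\vartheta)$, $i_0=\min I_0$ and $I_0'=I_0\setminus\{i_0\}$. If (T1), (T2), (D1), (D2), (D3), (I1) and (I2) are satisfied, then $$\mathrm{FDR}_\vartheta(\varphi_{(n)})\le\frac{n_0}{n}\sum_{j=1}^n\overline q(j/n)\,P_{\vartheta^{i_0}}(R_n/n=j/n)=\frac{n_0}{n}\,\mathbb E_{\vartheta^{i_0}}\,\overline q(R_n/n),$$ with equality in the first inequality if $\varphi_{(n)}$ is a step-up test and (A2) holds in addition. If (T1), (T2), (D1), (D2), (D3), (I1), (I2) and (A1) are fulfilled, then $$\mathrm{FDR}_\vartheta(\varphi_{(n)})\le\frac{n_0}{n}\,\mathbb E_{I_0'}\,\overline q(R_n/n).$$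
   Context: Let $(\mathcal X,\mathcal A,\{P_\vartheta:\vartheta\in\Theta\})$ be a statistical experiment, $(H_i)_{i\in\mathbb N}$ a sequence of null hypotheses with $\varnothing\neq H_i\subset\Theta$, and $(p_i)_{i\in\mathbb N}$ a sequence of $p$-values, i.e. measurable maps $p_i:\mathcal X\to[0,1]$ with $0<P_\vartheta(p_i\le x)\le x$ for all $\vartheta\in H_i$, $i\in\mathbb N$, $x\in(0,1]$. Put $\mathbb N_n=\{1,\dots,n\}$, $I_0(\vartheta)=\{i\in\mathbb N:\vartheta\in H_i\}$, $I_1(\vartheta)=\mathbb N\setminus I_0(\vartheta)$, $I_{n,j}(\vartheta)=I_j(\vartheta)\cap\mathbb N_n$, $n_j=|I_{n,j}(\vartheta)|$, $j=0,1$. $H_i$ is true under $\vartheta$ if $\vartheta\in H_i$. The space is assumed rich enough to carry the following probability measures (not necessarily belonging to $\{P_\vartheta:\vartheta\in\Theta\}$). For $I_0\subseteq\mathbb N$, the Dirac-uniform configuration $P_{I_0}$ (expectation $\mathbb E_{I_0}$), under which the $p_i$, $i\in I_0$, are i.i.d. uniform on $[0,1]$ and $p_i=0$ almost surely for $i\notin I_0$. For $\vartheta\in\Theta$ and $i\in I_0(\vartheta)$, a measure $P_{\vartheta^i}$ (expectation $\mathbb E_{\vartheta^i}$) under which $(p_k)_{k\in\mathbb N}$ has the same distribution as $(p_k^i)_{k\in\mathbb N}$ under $P_\vartheta$, where $p^i_k=p_k$ for $k\ne i$ and $p^i_i\equiv0$. A (non-randomized) multiple test procedure is $\varphi_{(n)}=(\varphi_1,\dots,\varphi_n)$,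 a $\{0,1\}^n$-valued function of $p_1,\dots,p_n$, where $\varphi_i=1$ means that $H_i$ is rejected. $V_n=|\{i\in\mathbb N_n:\varphi_i=1,\ \vartheta\in H_i\}|$, $R_n=|\{i\in\mathbb N_n:\varphi_i=1\}|$, and $\mathrm{FDR}_\vartheta(\varphi_{(n)})=\mathbb E_\vartheta[V_n/(R_n\vee 1)]$. A critical value function is a nondecreasing continuous $\rho:[0,1]\to[0,1]$ with $\rho(0)=0$ and $\rho>0$ on $(0,1]$. Define $q(x)=\rho(x)/x$ for $x\in(0,1]$, assume $q(0):=\limsup_{x\downarrow0}q(x)<\infty$, and put $\overline q(x)=\max_{0\le t\le x}q(t)$, $x\in[0,1]$. Conditions: (T1) For all $i\in\mathbb N_n$: $p_i\le\alpha_{1:n}$ implies $\varphi_i=1$. (T2) For all $j\in\mathbb N_n$: $R_n=j$ implies that for all $i\in\mathbb N_n$: $\varphi_i=1\Leftrightarrow p_i\le\alpha_{j:n}$. (D1) For all $\vartheta\in\Theta$, $j\in\mathbb N_n$, $i\in I_{n,0}(\vartheta)$: $P_\vartheta(R_n\ge j\mid p_i\le t)$ is nonincreasing in $t\in(0,\alpha_{j:n}]$. (D2) For all $\vartheta\in\Theta$, $j\in\mathbb N_n$, $i\in I_{n,0}(\vartheta)$, $t\in(0,\alpha_{j:n}]$: $P_\vartheta(R_n\ge j\mid p_i\le t)\le P_{\vartheta^i}(R_n\ge j)$. (D3) For all $\vartheta\in\Theta$ and $i\in I_{n,0}(\vartheta)$: $p_i$ is uniformly distributed on $[0,1]$ under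 $P_\vartheta$. (I1) For all $\vartheta\in\Theta$: the $p_i$, $i\in I_{n,0}(\vartheta)$, are i.i.d. under $P_\vartheta$. (I2) For all $\vartheta\in\Theta$: $(p_i:i\in I_{n,0}(\vartheta))$ and $(p_i:i\in I_{n,1}(\vartheta))$ are stochastically independent random vectors under $P_\vartheta$. (A1) If $(p_1,\dots,p_n)$ is stochastically not greater under $\vartheta_1\in\Theta$ than under $\vartheta_2\in\Theta$, then $\varphi_{(n)}$ is stochastically not greater under $\vartheta_2\in\Theta$ than under $\vartheta_1\in\Theta$. (''Stochastically not greater'' refers to the usual multivariate stochastic order: expectations of all nondecreasing functions are ordered whenever they exist.) (A2) $\rho(x)/x$ is nondecreasing for $x\in(0,1]$. The step-up test with critical values $\alpha_{1:n}\le\dots\le\alpha_{n:n}$ is: with ordered $p$-values $p_{1:n}\le\dots\le p_{n:n}$, let $m=\max\{j\in\mathbb N_n:p_{j:n}\le\alpha_{j:n}\}$; set $\varphi_i=1$ iff $p_i\le\alpha_{m:n}$ (no rejection if the set is empty).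
   Formalization: Both inequalities are proved for procedures whose decisions are permuted along with the p-values (they fail for asymmetric ones), and (A1) is required not only on Θ but also for the measures P_{ϑ^i} and P_I, without which the last inequality fails. *)

(* Defs.v *)
From HB Require Import structures.
From mathcomp Require Import all_boot all_order all_algebra all_fingroup.
From mathcomp Require Import all_classical all_reals all_analysis.

Set Implicit Arguments.
Unset Strict Implicit.
Unset Printing Implicit Defensive.

Import Order.TTheory GRing.Theory Num.Theory.
Import numFieldNormedType.Exports.

Local Open Scope classical_set_scope.
Local Open Scope ring_scope.

(* Hypotheses and p-values are numbered from 0: index i stands for H_{i+1},
   and {1, ..., n} becomes [set i | i < n] or 'I_n.  Counts (values of R_n) and
   the subscripts j of the critical values alpha_{j:n} still run over 1..n. *)

Section probability.
Context {d : measure_display} {X : measurableType d} {R : realType}.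
Implicit Types (P Q : probability X R) (p : nat -> {mfun X >-> R}).

(* P(A | B) *)
Definition cprob P (A B : set X) : R := fine (P (A `&` B)) / fine (P B).

Definition mutually_independent P p (J : set nat) : Prop :=
  forall s : seq nat, uniq s -> (forall i, i \in s -> J i) ->
  forall B : nat -> set R, (forall i, measurable (B i)) ->
  P (\big[setI/setT]_(i <- s) (p i @^-1` B i))
  = (\prod_(i <- s) P (p i @^-1` B i))%E.

Definition identically_distributed P p (J : set nat) : Prop :=
  forall i k, J i -> J k -> forall B : set R, measurable B ->
  distribution P (p i) B = distribution P (p k) B.

Definition iid P p (J : set nat) : Prop :=
  mutually_independent P p J /\ identically_distributed P p J.

Definition sigma_generated p (J : set nat) : set (set X) :=
  <<s \bigcup_(i in J) preimage_set_system setT (p i) measurable >>.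

Definition independent_vectors P p (J K : set nat) : Prop :=
  forall A B, sigma_generated p J A -> sigma_generated p K B ->
  P (A `&` B) = (P A * P B)%E.

Definition uniform01 P (Y : {mfun X >-> R}) : Prop :=
  forall B : set R, measurable B ->
  distribution P Y B = uniform_prob (@ltr01 R) B.

Definition dirac_uniform P p (I : set nat) : Prop :=
  [/\ mutually_independent P p I,
      forall i, I i -> uniform01 P (p i) &
      forall i, ~ I i -> {ae P, forall x, p i x = 0}].

Definition sequence_sigma_algebra : set (set (nat -> R)) :=
  <<s \bigcup_k preimage_set_system setT (fun w : nat -> R => w k) measurable >>.

(* (p_k)_k has under Q the law of (p_k)_k, with p_i replaced by 0, under P *)
Definition zeroed_law Q P p (i : nat) : Prop :=
  forall A, sequence_sigma_algebra A ->
  Q ((fun x k => p k x) @^-1` A)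
  = P ((fun x k => if k == i then 0 else p k x) @^-1` A).

(* le is the partial order on the value space of U *)
Definition stoch_le d' (T : measurableType d') (le : rel T) P Q (U : X -> T)
  : Prop :=
  forall f : T -> R, measurable_fun setT f ->
  (forall u v, le u v -> f u <= f v) ->
  P.-integrable setT (fun x => (f (U x))%:E) ->
  Q.-integrable setT (fun x => (f (U x))%:E) ->
  ('E_P[fun x => f (U x)] <= 'E_Q[fun x => f (U x)])%E.

End probability.

Definition tuple_le n (T : Type) (le : rel T) : rel (n.-tuple T) :=
  fun u v => [forall i, le (tnth u i) (tnth v i)].

Section critical_values.
Context {R : realType}.
Implicit Types (rho : R -> R) (x : R).

Definition q0 rho : \bar R := limf_esup (fun y => (rho y / y)%:E) (0 : R)^'+.

(* Only the restriction of rho to [0, 1] matters. *)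
Definition critical_value_function rho : Prop :=
  [/\ {within `[0, 1], continuous rho},
      {in `[0, 1] &, {homo rho : x y / x <= y}},
      (forall x, x \in `[0, 1] -> rho x \in `[0, 1]),
      rho 0 = 0 /\ (forall x, x \in `]0, 1] -> 0 < rho x) &
      (q0 rho < +oo)%E].

Definition q rho x : R := if x == 0 then fine (q0 rho) else rho x / x.

(* the supremum is attained, because q is upper semicontinuous on [0, 1] *)
Definition qbar rho x : R := sup [set q rho t | t in `[0, x]].

Definition alpha rho (n j : nat) : R := rho (j%:R / n%:R).

End critical_values.

Section multiple_tests.
Context {d : measure_display} {X : measurableType d} {R : realType}.
Context {Theta : Type}.
Variables (P : Theta -> probability X R) (H : nat -> set Theta).
Variable p : nat -> {mfun X >-> R}.
(* Pz theta i and PU I are the measures P_{theta^i} and P_I; Pz theta i is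
   meaningful only for a true hypothesis i. *)
Variables (Pz : Theta -> nat -> probability X R).
Variables (PU : set nat -> probability X R).
Variables (n : nat) (phi : {mfun n.-tuple R >-> n.-tuple bool}) (rho : R -> R).

Definition is_pvalues : Prop :=
  (forall i x, p i x \in `[0, 1]) /\
  (forall i theta t, H i theta -> t \in `]0, 1] ->
    (0 < P theta [set x | (p i x <= t)%R] <= t%:E)%E).

Definition I0 (theta : Theta) : set nat := [set i | H i theta].
Definition I1 (theta : Theta) : set nat := ~` I0 theta.
Definition In0 (theta : Theta) : set nat := I0 theta `&` [set i | (i < n)%N].
Definition In1 (theta : Theta) : set nat := I1 theta `&` [set i | (i < n)%N].

Definition pvec (x : X) : n.-tuple R := [tuple p i x | i < n].
Definition test (x : X) : n.-tuple bool := phi (pvec x).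
Definition rejected (x : X) (i : 'I_n) : bool := tnth (test x) i.

Definition Rn (x : X) : nat := #|[pred i | rejected x i]|.
Definition Vn (theta : Theta) (x : X) : nat :=
  #|[pred i : 'I_n | rejected x i && `[< H i theta >]]|.

Definition FDR (theta : Theta) : \bar R :=
  'E_(P theta)[fun x => (Vn theta x)%:R / (maxn (Rn x) 1)%:R].

Definition T1 : Prop :=
  forall x (i : 'I_n), p i x <= alpha rho n 1 -> rejected x i.

Definition T2 : Prop :=
  forall j, (1 <= j <= n)%N -> forall x, Rn x = j ->
  forall i : 'I_n, rejected x i <-> p i x <= alpha rho n j.

Definition D1 : Prop :=
  forall theta j i, (1 <= j <= n)%N -> In0 theta i ->
  {in `]0, alpha rho n j] &, {homo
    (fun t => cprob (P theta) [set x | (j <= Rn x)%N] [set x | p i x <= t])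
    : s t /~ s <= t}}.

Definition D2 : Prop :=
  forall theta j i, (1 <= j <= n)%N -> In0 theta i ->
  forall t, t \in `]0, alpha rho n j] ->
  ((cprob (P theta) [set x | (j <= Rn x)%N] [set x | (p i x <= t)%R])%:E
   <= Pz theta i [set x | (j <= Rn x)%N])%E.

Definition D3 : Prop :=
  forall theta i, In0 theta i -> uniform01 (P theta) (p i).

Definition Ind1 : Prop := forall theta, iid (P theta) p (In0 theta).

Definition Ind2 : Prop :=
  forall theta, independent_vectors (P theta) p (In0 theta) (In1 theta).

(* The parameter range of the monotonicity condition A1 is Theta augmented by
   the configurations theta^i and by the Dirac-uniform ones: A1 serves to
   compare P_{theta^i} with P_I, which need not be members of the experiment. *)
Definition configuration (Q : probability X R) : Prop :=
  [\/ exists theta, Q = P theta,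
      exists theta i, H i theta /\ Q = Pz theta i |
      exists I, Q = PU I].

Definition A1 : Prop :=
  forall Q1 Q2, configuration Q1 -> configuration Q2 ->
  stoch_le (@tuple_le n R <=%R) Q1 Q2 pvec ->
  stoch_le (@tuple_le n bool implb) Q2 Q1 test.

Definition A2 : Prop :=
  {in `]0, 1] &, {homo (fun x => rho x / x) : x y / x <= y}}.

(* Relabelling the p-values relabels the decisions.  This is tacit for
   procedures given by critical values.  A single index i_0 can stand for all
   true hypotheses only under this proviso: let n = 4, p_1, p_2 i.i.d. uniform
   with H_1, H_2 true, p_3 = p_4 = u in (alpha_2, alpha_3] with H_3, H_4 false,
   and use the step-up test if p_2 <= alpha_4 and the step-down test otherwise.
   With alpha = (.001, .002, .1, .14) all other conditions hold and the FDR is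
   at least .028, while the bound for i_0 = 1 is below .012. *)
Definition permutation_equivariant : Prop :=
  forall (s : 'S_n) (u : n.-tuple R), (forall i, tnth u i \in `[0, 1]) ->
  forall i, tnth (phi [tuple tnth u (s k) | k < n]) i = tnth (phi u) (s i).

(* the order statistic p_{j:n}, for j in 1..n *)
Definition ordered_pvalue (x : X) (j : nat) : R :=
  nth 0 (sort <=%R (pvec x)) j.-1.

(* equal to 0 if no j qualifies *)
Definition step_up_index (x : X) : nat :=
  \max_(j < n.+1 | (0 < j)%N && (ordered_pvalue x j <= alpha rho n j)) j.

Definition is_step_up : Prop :=
  forall x (i : 'I_n), rejected x i <->
    (0 < step_up_index x)%N /\ p i x <= alpha rho n (step_up_index x).

End multiple_tests.

(* Main.v *)
From HB Require Import structures.
Require Import Defs.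
From mathcomp Require Import all_boot all_order all_algebra all_fingroup.
From mathcomp Require Import all_classical all_reals all_analysis.
From mathcomp Require Import measurable_realfun ring lra.

Set Implicit Arguments.
Unset Strict Implicit.
Unset Printing Implicit Defensive.

Import Order.TTheory GRing.Theory Num.Theory.
Import numFieldNormedType.Exports.

Local Open Scope classical_set_scope.
Local Open Scope ring_scope.

(** Write N for the number of rejections, a_j = rho (j/n) and q_j = q (j/n).
When N = j, the rejected hypotheses are those with p_i <= a_j, so the false
discovery proportion is the sum over true i and over j of
[N = j, p_i <= a_j] / j.  A true p_i is uniform, hence P (p_i <= a_j) = a_j,
and 1/j = q_j / (n a_j); this turns the FDR into
  1/n * sum_i sum_j q_j * P (N = j | p_i <= a_j)        ([FDR_cprob]).

Fix i.  After q has been replaced by its running maximum qbar, summation by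
parts expresses the inner sum through the tails P (N >= j | p_i <= a_j) with
the nonnegative weights qbar_j - qbar_(j-1), where qbar_0 is read as 0.  The
condition D1 compares conditioning on p_i <= a_j and on p_i <= a_(j+1), so that
the differences telescope;
  D2 bounds each tail by its value under the law with p_i set to 0
([sum_by_parts_le], [weighted_cprob_le]).  The p-values of the true hypotheses
are exchangeable, also jointly with the other ones, so for a symmetric
procedure the law of N with p_i set to 0 is the same for every true i
([prob_pvec_tperm], [Pz_symmetric]); summing over i gives the factor n0.

For a step-up test nothing is lost.  On p_i <= a_j, whether N >= k holds for a
k >= j depends only on the p-values with p_i replaced by 0
([step_up_count_zero]), and these are independent of p_i
([prob_indep_coordinate]); so both tails above equal the unconditional ones.
Under A2 moreover qbar = q ([qbar_A2]).

For the last bound, the p-values of the Dirac-uniform configuration are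
distributed like the original ones with every coordinate outside I0' set to 0,
while theta^(i0) only sets coordinate i0 to 0.  The former vector is below the
latter ([dirac_stoch_le]), A1 reverses the order for the decisions, and
qbar (N/n) is a nondecreasing function of the decisions.

Equalities between laws of vectors of p-values are checked on boxes, where
independence turns probabilities into products ([eq_law_boxes]). *)

(** * The ratio rho (x) / x and its running maximum *)

Section critical_value_ratio.
Context {R : realType}.
Variable rho : R -> R.
Hypothesis rho_cvf : critical_value_function rho.

Lemma ratio_gt0 x : 0 < x <= 1 -> 0 < q rho x.
Proof.
move=> x01; rewrite /q gt_eqF; last by case/andP: x01.
case: rho_cvf => _ _ _ [_ rho_gt0] _; rewrite divr_gt0 ?rho_gt0 ?in_itv//=.
by case/andP: x01.
Qed.

(** Near 0 this is the finiteness of the limit superior; away from 0 it holds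
because rho <= 1.  Hence the supremum defining qbar is taken over a bounded set. *)
Lemma ratio_bounded : exists M, forall t, 0 <= t <= 1 -> q rho t <= M.
Proof.
case: rho_cvf => _ _ rho01 _ q0oo.
have : exists2 V : set R, (0 : R)^'+ V &
    (ereal_sup ((fun y => (rho y / y)%:E) @` V) < +oo)%E.
  apply: contrapT => noV; have : (+oo <= q0 rho)%E.
    apply: le_ereal_inf_tmp => _ [V V0 <-]; rewrite leNgt; apply/negP => ltoo.
    by apply: noV; exists V.
  by rewrite leNgt q0oo.
move=> [V V0 Voo].
have [e e0 eV] : exists2 e : R, 0 < e & forall y, 0 < y < e -> V y.
  case: V0 => e /= e0 eV; exists e => // y /andP[y0 ye].
  by apply: eV => //=; rewrite sub0r normrN gtr0_norm.
have [M VM] : exists M, forall y, V y -> rho y / y <= M.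
  exists (fine (ereal_sup ((fun y => (rho y / y)%:E) @` V))) => y Vy.
  have yV : ((rho y / y)%:E <= ereal_sup ((fun y => (rho y / y)%:E) @` V))%E.
    by apply: ereal_sup_ubound; exists y.
  rewrite -lee_fin fineK// fin_numElt Voo andbT.
  by rewrite (lt_le_trans _ yV)// ltNyr.
exists (Num.max (fine (q0 rho)) (Num.max M e^-1)) => t /andP[t0 t1].
rewrite /q; have [_|tn0] := eqVneq t 0; first by rewrite le_max lexx.
have {tn0}t0 : 0 < t by rewrite lt_neqAle eq_sym tn0.
rewrite !le_max; have [te|et] := ltP t e.
  by rewrite VM ?orbT//; apply: eV; rewrite t0.
have : rho t \in `[0, 1] by apply: rho01; rewrite in_itv/= ltW.
rewrite in_itv/= => /andP[rt0 rt1]; apply/orP; right; apply/orP; right.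
by rewrite -[leRHS]mul1r ler_pM ?invr_ge0 ?(ltW t0)// lef_pV2 ?posrE.
Qed.

Lemma ratio_le_qbar t x : 0 <= t <= x -> x <= 1 -> q rho t <= qbar rho x.
Proof.
move=> /andP[t0 tx] x1; have [M qM] := ratio_bounded.
apply: sup_ubound; last by exists t => //=; rewrite in_itv/= t0.
exists M => _ [s + <-]; rewrite /= in_itv/= => /andP[s0 sx].
by apply: qM; rewrite s0 (le_trans sx).
Qed.

Lemma qbar_nondecreasing x y : 0 <= x <= y -> y <= 1 -> qbar rho x <= qbar rho y.
Proof.
move=> /andP[x0 xy] y1; apply: ge_sup.
  by exists (q rho x), x => //=; rewrite in_itv/= x0 lexx.
move=> _ [t + <-]; rewrite /= in_itv/= => /andP[t0 tx].
by apply: ratio_le_qbar => //; rewrite t0 (le_trans tx).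
Qed.

(** If rho (x) / x is nondecreasing, its limit superior at 0 is a lower bound
of its values, so the running maximum is attained at the right end. *)
Lemma qbar_A2 x : A2 rho -> 0 < x <= 1 -> qbar rho x = q rho x.
Proof.
move=> qmono /andP[x0 x1]; apply/eqP; rewrite eq_le; apply/andP; split; last first.
  by apply: ratio_le_qbar => //; rewrite lexx ltW.
apply: ge_sup.
  by exists (q rho x), x => //=; rewrite in_itv/= lexx ltW.
move=> _ [t + <-]; rewrite /= in_itv/= => /andP[t0 tx].
have ratio_mono s : 0 < s <= x -> rho s / s <= rho x / x.
  move=> /andP[s0 sx]; apply: qmono => //; rewrite in_itv/=.
    by rewrite s0 (le_trans sx).
  by rewrite x0.
rewrite {2}/q (gt_eqF x0); move: t0; rewrite le_eqVlt => /predU1P[<-|t0]; last first.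
  by rewrite /q gt_eqF// ratio_mono// t0.
(* The limit superior is at most the supremum over ]0, x]. *)
have : (q0 rho <= (rho x / x)%:E)%E.
  apply: (@le_trans _ _ (ereal_sup ((fun y => (rho y / y)%:E) @` `]0, x]))).
    apply: ereal_inf_lbound; exists `]0, x]%classic => //.
    exists x => // y; rewrite /= sub0r normrN => yx y0.
    by rewrite in_itv/= y0 (le_trans (ler_norm _)) ?ltW.
  apply: ge_ereal_sup => _ [s sx <-]; rewrite lee_fin; move: sx; rewrite /= in_itv/=.
  exact: ratio_mono.
have : 0 <= rho x / x by have := @ratio_gt0 x;
  rewrite /q gt_eqF// x0 x1 => /(_ isT)/ltW.
rewrite /q eqxx; case: (q0 rho) => //= r _; rewrite lee_fin.
Qed.

End critical_value_ratio.

(** * Boxes and measures on tuples *)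

Section boxes.
Context {R : realType} {n : nat}.
Implicit Types B : nat -> set R.

Definition box B : set (n.-tuple R) :=
  [set u | forall k : 'I_n, B k (tnth u k)].

Definition measurable_boxes : set (set (n.-tuple R)) :=
  [set box B | B in [set B | forall k, measurable (B k)]].

Lemma measurable_box B : (forall k, measurable (B k)) -> measurable (box B).
Proof.
move=> mB; rewrite (_ : box B =
    \bigcap_(k in [set: 'I_n]) ((@tnth n R)^~ k @^-1` B k)); last first.
  by apply/seteqP; split => u uB k; [move=> _|]; exact: uB.
apply: fin_bigcap_measurable => [|k _]; first exact: finite_finset.
by rewrite -[X in measurable X]setTI; exact: measurable_tnth.
Qed.

Lemma measurable_tupleE :
  @measurable _ (n.-tuple R) = <<s measurable_boxes >>.
Proof.
apply/seteqP; split; last first.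
  apply: smallest_sub; first exact: sigma_algebra_measurable.
  by move=> _ [B mB <-]; exact: measurable_box.
apply: smallest_sub; first exact: smallest_sigma_algebra.
move=> A; rewrite -bigcup_seq => -[k _ [C mC <-]].
apply: sub_gen_smallest; exists (fun j => if j == k :> nat then C else setT).
  by move=> j; case: ifP.
apply/seteqP; split => u /=.
  by move=> /(_ k); rewrite eqxx.
by move=> [_ uC] j; case: ifPn => // /eqP /ord_inj ->.
Qed.

Lemma setI_closed_boxes : setI_closed measurable_boxes.
Proof.
move=> _ _ [B mB <-] [C mC <-]; exists (fun k => B k `&` C k).
  by move=> k; exact: measurableI.
apply/seteqP; split => u /=; first by move=> uBC; split => k; case: (uBC k).
by move=> [uB uC] k; split.
Qed.

Lemma boxT : measurable_boxes [set: n.-tuple R].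
Proof.
by exists (fun=> setT) => //; apply/seteqP; split.
Qed.

Lemma eq_measure_boxes (m1 m2 : {measure set (n.-tuple R) -> \bar R}) :
  (m1 setT < +oo)%E ->
  (forall B, (forall k, measurable (B k)) -> m1 (box B) = m2 (box B)) ->
  forall A, measurable A -> m1 A = m2 A.
Proof.
move=> m1oo m12; apply: (measure_unique measurable_boxes (fun=> setT)) => //.
- exact: measurable_tupleE.
- exact: setI_closed_boxes.
- by move=> _; exact: boxT.
- by rewrite bigcup_const//; exists 0%N.
- by move=> _ [B mB <-]; exact: m12.
Qed.

(** Boxes are stable under intersection and generate the product sigma-algebra,
so the law of a random tuple is determined by its values on boxes. *)
Lemma eq_law_boxes d (X : measurableType d) (P Q : probability X R)
    (f g : X -> n.-tuple R) :
  measurable_fun setT f -> measurable_fun setT g ->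
  (forall B, (forall k, measurable (B k)) ->
    P (f @^-1` box B) = Q (g @^-1` box B)) ->
  forall A, measurable A -> P (f @^-1` A) = Q (g @^-1` A).
Proof.
move=> mf mg fg A mA.
pose F : {mfun X >-> n.-tuple R} := HB.pack f (isMeasurableFun.Build _ _ _ _ f mf).
pose G : {mfun X >-> n.-tuple R} := HB.pack g (isMeasurableFun.Build _ _ _ _ g mg).
apply: (@eq_measure_boxes (distribution P F) (distribution Q G)) => //.
by rewrite /= /distribution /pushforward preimage_setT probability_setT ltry.
Qed.

(** Both sides are finite measures in A: the law of f on the event D, and the
law of f scaled by P D. *)
Lemma indep_event_boxes d (X : measurableType d) (P : probability X R)
    (f : X -> n.-tuple R) (D : set X) :
  measurable_fun setT f -> measurable D ->
  (forall B, (forall k, measurable (B k)) ->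
    P (D `&` f @^-1` box B) = (P D * P (f @^-1` box B))%E) ->
  forall A, measurable A -> P (D `&` f @^-1` A) = (P D * P (f @^-1` A))%E.
Proof.
move=> mf mD fD A mA.
pose F : {mfun X >-> n.-tuple R} := HB.pack f (isMeasurableFun.Build _ _ _ _ f mf).
have PD0 : 0 <= fine (P D) by exact: fine_ge0.
have := @eq_measure_boxes (pushforward (mrestr P mD) F)
  (mscale (NngNum PD0) (distribution P F)).
rewrite /= /mscale/= /distribution /pushforward /mrestr.
have PDE : (fine (P D))%:E = P D by rewrite fineK// fin_num_measure.
rewrite PDE => indep; rewrite setIC; apply: indep => //= [|B mB];
  last by rewrite setIC fD.
by rewrite preimage_setT setTI ltey_eq fin_num_measure.
Qed.

End boxes.

Lemma measurable_tuple_bool n (A : set (n.-tuple bool)) : measurable A.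
Proof.
apply: countable_measurable => [t|]; last exact: countableP.
rewrite (_ : [set t] =
    \bigcap_(k in [set: 'I_n]) ((@tnth n bool)^~ k @^-1` [set tnth t k])).
  apply: fin_bigcap_measurable => [|k _]; first exact: finite_finset.
  by rewrite -[X in measurable X]setTI; exact: measurable_tnth.
apply/seteqP; split => [u -> //|u ut].
by apply: eq_from_tnth => k; exact: ut.
Qed.

(** * Joint laws of the p-values *)

Section tuple_maps.
Context {R : realType} {n : nat}.

(** Serves both configurations: theta^i keeps the coordinates other than i, and
a Dirac-uniform configuration on I keeps those in I. *)
Definition zero_outside (K : set nat) (u : n.-tuple R) : n.-tuple R :=
  [tuple if `[< K k >] then tnth u k else 0 | k < n].

Definition permute (s : 'S_n) (u : n.-tuple R) : n.-tuple R :=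
  [tuple tnth u (s k) | k < n].

Lemma measurable_zero_outside K : measurable_fun setT (zero_outside K).
Proof.
apply/measurable_fun_tnthP => k; rewrite /comp/=.
under eq_fun do rewrite tnth_mktuple.
by case: asbool; [exact: measurable_tnth|exact: measurable_cst].
Qed.

Lemma measurable_permute s : measurable_fun setT (permute s).
Proof.
apply/measurable_fun_tnthP => k; rewrite /comp/=.
under eq_fun do rewrite tnth_mktuple.
exact: measurable_tnth.
Qed.

End tuple_maps.

Section pvalue_vector.
Context {d : measure_display} {X : measurableType d} {R : realType}.
Implicit Types (P Q : probability X R) (B : nat -> set R) (J K : set nat).
Variables (p : nat -> {mfun X >-> R}) (n : nat).

Local Notation U := (uniform_prob (@ltr01 R)).
Local Notation pv := (pvec p n).
Local Notation lt_n := [set k | (k < n)%N].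

Definition cylinder K B : set X := [set x | forall k, K k -> B k (p k x)].

Lemma measurable_pvec : measurable_fun setT pv.
Proof.
apply/measurable_fun_tnthP => k; rewrite /comp/=.
by under eq_fun do rewrite tnth_mktuple; exact: measurable_funPT.
Qed.

Lemma measurable_preimage_pvec (f : n.-tuple R -> n.-tuple R) A :
  measurable_fun setT f -> measurable A -> measurable ((f \o pv) @^-1` A).
Proof.
move=> mf mA; rewrite -[X in measurable X]setTI.
by apply: measurableT_comp => //; exact: measurable_pvec.
Qed.

Lemma sigma_generated_cylinder K B : (forall k, measurable (B k)) ->
  sigma_generated p K (cylinder K B).
Proof.
move=> mB; rewrite /sigma_generated; set G := \bigcup_(i in K) _.
rewrite (_ : cylinder K B = \bigcap_(k in K) (p k @^-1` B k))//.
apply: (@bigcap_measurableType _ (g_sigma_algebraType G)) => k Kk.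
apply: sub_gen_smallest; exists k => //; exists (B k) => //.
by rewrite setTI.
Qed.

Lemma preimage_pvec_box B : pv @^-1` box B = cylinder lt_n B.
Proof.
apply/seteqP; split => x /= xB k.
  by move=> kn; have := xB (Ordinal kn); rewrite tnth_mktuple.
by rewrite tnth_mktuple; exact: (xB k (ltn_ord k)).
Qed.

Lemma mutually_independentS P J K : K `<=` J ->
  mutually_independent P p J -> mutually_independent P p K.
Proof. by move=> KJ indJ s us sK; apply: indJ => // i /sK /KJ. Qed.

Lemma prob_cylinder_indep P J B :
  mutually_independent P p (J `&` lt_n) ->
  (forall i, (J `&` lt_n) i -> uniform01 P (p i)) ->
  (forall k, measurable (B k)) ->
  P (cylinder (J `&` lt_n) B) = (\prod_(k < n | `[< J k >]) U (B k))%E.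
Proof.
move=> indJ unifJ mB; pose s := [seq k <- index_iota 0 n | `[< J k >]].
have sJ k : k \in s <-> (J `&` lt_n) k.
  rewrite mem_filter mem_index_iota/=; split => [/andP[/asboolP]//|[Jk kn]].
  by rewrite asboolT.
rewrite (_ : cylinder _ _ = \big[setI/setT]_(k <- s) (p k @^-1` B k)); last first.
  rewrite -bigcap_seq; apply/seteqP; split => x /= xB k.
    by move=> /sJ Jk; exact: xB.
  by move=> Jk; apply: xB; exact/sJ.
rewrite indJ ?filter_uniq ?iota_uniq//; last by move=> k /sJ.
rewrite big_filter big_mkord; apply: eq_bigr => k /asboolP Jk.
by have /(_ _ (mB k)) <- := @unifJ k (conj Jk (ltn_ord k)).
Qed.

Section iid_block.
Variables (P : probability X R) (J : set nat).
Hypothesis indJ : mutually_independent P p (J `&` lt_n).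
Hypothesis unifJ : forall i, (J `&` lt_n) i -> uniform01 P (p i).
Hypothesis indJC : independent_vectors P p (J `&` lt_n) (~` J `&` lt_n).

Lemma prob_pvec_box B : (forall k, measurable (B k)) ->
  P (pv @^-1` box B) =
  (\prod_(k < n | `[< J k >]) U (B k) * P (cylinder (~` J `&` lt_n) B))%E.
Proof.
move=> mB; rewrite -(prob_cylinder_indep indJ unifJ mB).
rewrite -indJC; [|exact: sigma_generated_cylinder..].
congr (P _); rewrite preimage_pvec_box; apply/seteqP; split => x.
  by move=> xB; split => k [_ /= kn]; exact: xB.
by move=> [xJ xJC] k kn; have [Jk|Jk] := pselect (J k); [exact: xJ|exact: xJC].
Qed.

(** Exchangeability of the p-values in J.  The remaining coordinates are not
moved, and they are independent of the block J, so the probability of a box is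
a product of which only the first factor is reordered. *)
Lemma prob_pvec_tperm (i j : 'I_n) A : J i -> J j -> measurable A ->
  P ((permute (tperm i j) \o pv) @^-1` A) = P (pv @^-1` A).
Proof.
move=> Ji Jj; set s := tperm i j.
have sJ k : J (s k) <-> J k by rewrite /s; case: tpermP => [->|->|].
apply: eq_law_boxes.
- by apply: measurableT_comp; [exact: measurable_permute|exact: measurable_pvec].
- exact: measurable_pvec.
(* Sides of the permuted box; they are indexed by nat, hence the default. *)
move=> B mB; pose sB k := if insub k is Some k' then B (s k' : 'I_n) else setT.
have msB k : measurable (sB k) by rewrite /sB; case: insub.
have sBE (k : 'I_n) : sB k = B (s k) by rewrite /sB valK.
rewrite (_ : _ @^-1` _ = pv @^-1` box sB); last first.
  apply/seteqP; split => x /= xB k.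
    by rewrite sBE; have := xB (s k); rewrite tnth_mktuple /s tpermK.
  by rewrite tnth_mktuple; have := xB (s k); rewrite sBE /s tpermK.
rewrite !prob_pvec_box//; congr (_ * P _)%E.
  rewrite (reindex_inj (@perm_inj _ s))/=; apply: eq_big => [k|k _].
    by apply/asboolP/asboolP; rewrite sJ.
  by rewrite sBE /s tpermK.
suff sB_out k : (~` J `&` lt_n) k -> sB k = B k.
  by apply/seteqP; split => x xB k Jk; have := xB k Jk; rewrite sB_out.
move=> [Jk kn]; rewrite (sBE (Ordinal kn)) /s.
by case: tpermP => //= ke; case: Jk; move/(congr1 val): ke => /= ->.
Qed.

(** A single p-value of the independent block is independent of the vector of
all the others, including those outside of the block. *)
Lemma prob_indep_coordinate (i : 'I_n) C A :
  J i -> measurable C -> measurable A ->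
  P (p i @^-1` C `&` (zero_outside (~` [set val i]) \o pv) @^-1` A) =
  (P (p i @^-1` C) * P ((zero_outside (~` [set val i]) \o pv) @^-1` A))%E.
Proof.
move=> Ji mC; move: A; apply: indep_event_boxes.
- by apply: measurableT_comp;
  [exact: measurable_zero_outside|exact: measurable_pvec].
- by rewrite -[X in measurable X]setTI; exact: measurable_funPT.
(* If 0 is not in side i of the box, both events are empty. *)
move=> B mB; have [Bi0|Bi0] := pselect (B i 0); last first.
  rewrite (_ : _ @^-1` box B = set0) ?setI0 ?measure0 ?mule0//.
  rewrite -subset0 => x /= /(_ i); rewrite tnth_mktuple.
  by case: asboolP => // ni _; exact: ni.
pose B' D k := if k == i :> nat then D else B k.
have mB' D k : measurable D -> measurable (B' D k) by rewrite /B'; case: ifP.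
have zeroE : (zero_outside (~` [set val i]) \o pv) @^-1` box B = pv @^-1` box (B' setT).
  apply/seteqP; split => x /= xB k; have := xB k; rewrite /B' !tnth_mktuple.
    by case: eqP => // ki; rewrite asboolT.
  case: eqP => [ki _|ki]; last by rewrite asboolT.
  by rewrite asboolF; [rewrite (ord_inj ki)|move/(_ ki)].
have interE : p i @^-1` C `&` pv @^-1` box (B' setT) = pv @^-1` box (B' C).
  apply/seteqP; split => x /=.
    by move=> [xC xB] k; have := xB k; rewrite /B' tnth_mktuple; case: eqP => // ->.
  move=> xB; split.
    by have := xB i; rewrite /B' eqxx tnth_mktuple.
  by move=> k; have := xB k; rewrite /B' tnth_mktuple; case: eqP.
rewrite zeroE interE !prob_pvec_box; [|by move=> k; exact: mB'..].
rewrite -[P (p i @^-1` C)]/(distribution P (p i) C) unifJ//; last by split => /=.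
rewrite !(bigD1 i (P := fun k : 'I_n => `[< J k >]))/=; [|exact/asboolP..].
rewrite {1 4}/B' eqxx [U setT]probability_setT mul1e !muleA.
congr (U C * _ * P _)%E.
  by apply: eq_bigr => k /andP[_ ki]; rewrite /B' -val_eqE/= in ki *;
    rewrite (negbTE ki).
apply/seteqP; split => x xB k [Jk kn]; have := xB k (conj Jk kn); rewrite /B';
  by case: eqP => // ki; case: Jk; rewrite ki.
Qed.

End iid_block.

(** The coordinates outside J are set to 0, so only the joint law of those in J
matters, and it is the uniform law on a cube under both measures. *)
Lemma prob_zero_outside_indep P Q J A :
  mutually_independent P p (J `&` lt_n) ->
  (forall i, (J `&` lt_n) i -> uniform01 P (p i)) ->
  mutually_independent Q p (J `&` lt_n) ->
  (forall i, (J `&` lt_n) i -> uniform01 Q (p i)) ->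
  measurable A ->
  P ((zero_outside J \o pv) @^-1` A) = Q ((zero_outside J \o pv) @^-1` A).
Proof.
move=> indP unifP indQ unifQ; move: A.
apply: eq_law_boxes.
- by apply: measurableT_comp;
  [exact: measurable_zero_outside|exact: measurable_pvec].
- by apply: measurableT_comp;
  [exact: measurable_zero_outside|exact: measurable_pvec].
move=> B mB; have [B0|B0] := pselect (forall k : 'I_n, ~ J k -> B k 0).
  rewrite (_ : _ @^-1` box B = cylinder (J `&` lt_n) B).
    by rewrite !prob_cylinder_indep.
  apply/seteqP; split => x /= xB k.
    move=> [Jk kn]; have := xB (Ordinal kn).
    by rewrite !tnth_mktuple/= asboolT.
  rewrite !tnth_mktuple; case: asboolP => Jk; last exact: B0.
  by apply: xB; split => /=.
rewrite (_ : _ @^-1` box B = set0) ?measure0//.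
rewrite -subset0 => x /= xB; apply: B0 => k Jk.
by have := xB k; rewrite tnth_mktuple asboolF.
Qed.

Lemma zeroed_law_pvec P Q i A : zeroed_law Q P p i -> measurable A ->
  Q (pv @^-1` A) = P ((zero_outside (~` [set i]) \o pv) @^-1` A).
Proof.
move=> QP mA.
set G := \bigcup_k preimage_set_system setT (fun w : nat -> R => w k) measurable.
(* Truncation of a sequence to its first n terms, through which pvec factors. *)
pose h (w : g_sigma_algebraType G) : n.-tuple R := [tuple w k | k < n].
have mh : measurable_fun setT h.
  apply/measurable_fun_tnthP => k; rewrite /comp/=.
  rewrite (_ : (fun w => tnth (h w) k) = fun w => w k); last first.
    by apply/funext => w; rewrite tnth_mktuple.
  move=> _ C mC; apply: sub_gen_smallest; exists k => //.
  by exists C.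
have mhA : sequence_sigma_algebra (h @^-1` A).
  by rewrite -[h @^-1` A]setTI; exact: mh.
have := QP _ mhA; congr (_ = P _) => //.
apply/seteqP; split => x; rewrite /preimage/=.
all: congr (A _); apply: eq_mktuple => k; rewrite tnth_mktuple.
all: case: eqP => ki; [rewrite asboolF//; exact|by rewrite asboolT].
Qed.

End pvalue_vector.

(** * Summation by parts, integrals and the uniform law *)

Lemma uniform_prob_le (R : realType) (t : R) : 0 <= t <= 1 ->
  uniform_prob (@ltr01 R) `]-oo, t] = t%:E.
Proof.
move=> /andP[t0 t1]; rewrite /uniform_prob integral_uniform_pdf.
rewrite (_ : _ `&` _ = `[0, t]%classic); last first.
  apply/seteqP; split => x; rewrite /= !in_itv/=.
    by move=> [-> /andP[-> _]].
  by move=> /andP[-> xt]; split => //=; exact: le_trans xt t1.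
rewrite (eq_integral (fun=> 1%:E)); last first.
  move=> x; rewrite inE/= in_itv/= /uniform_pdf => /andP[-> xt].
  by rewrite (le_trans xt)//= subr0 invr1.
rewrite integral_cst//= lebesgue_measure_itv/= lte_fin mul1e.
by move: t0; rewrite le_eqVlt => /predU1P[<-|->]; rewrite ?ltxx// sube0.
Qed.

(** As c_j >= a_(j+1), where a_(n+1) stands for b_(n+1), the left side is at most
the weighted telescoping sum of a.  The difference d = b - a is nonnegative
with d_(n+1) = 0, and by parts the sum of w_j (d_j - d_(j+1)) is the sum of
(w_j - w_(j-1)) d_j >= 0, where w_0 = 0. *)
Lemma sum_by_parts_le (R : realType) (n : nat) (w a b c : nat -> R) :
  (forall j, (1 <= j <= n)%N -> 0 <= w j) ->
  (forall j, (1 <= j < n)%N -> w j <= w j.+1) ->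
  (forall j, (1 <= j <= n)%N -> a j <= b j) ->
  (forall j, (1 <= j < n)%N -> a j.+1 <= c j) ->
  b n.+1 <= c n ->
  \sum_(1 <= j < n.+1) w j * (a j - c j) <=
  \sum_(1 <= j < n.+1) w j * (b j - b j.+1).
Proof.
case: n => [|n] w0 wS ab ac bc; first by rewrite !big_geq.
(* The extra term is the boundary term of the partial summation up to m + 1. *)
suff partial m : (m <= n)%N ->
    \sum_(1 <= j < m.+2) w j * (a j - c j) + w m.+1 * (c m.+1 - b m.+2) <=
    \sum_(1 <= j < m.+2) w j * (b j - b j.+1).
  apply: le_trans (partial n (leqnn n)); rewrite lerDl mulr_ge0 ?subr_ge0 ?w0//.
  by rewrite ltnS leqnn.
elim: m => [|m IHm] mn.
  have := ab 1%N isT; have := w0 1%N isT.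
  rewrite !big_nat1 => w1 ab1; rewrite -mulrDr ler_wpM2l//; lra.
rewrite [leLHS]/= !(big_nat_recr m.+2)//=.
have := IHm (ltnW mn).
have wm := wS m.+1 mn; have abm := ab m.+2 mn; have acm := ac m.+1 mn.
have wm0 := w0 m.+1 (ltnW mn).
set S := \sum_(1 <= _ < _) _; set S' := \sum_(1 <= _ < _) _ => IH.
have : w m.+1 * (b m.+2 - c m.+1) <= w m.+2 * (b m.+2 - a m.+2).
  apply: (@le_trans _ _ (w m.+1 * (b m.+2 - a m.+2))).
    by rewrite ler_wpM2l// lerB.
  by rewrite ler_wpM2r// subr_ge0.
lra.
Qed.

Section integrals.
Context {d : measure_display} {X : measurableType d} {R : realType}.
Implicit Types P Q : probability X R.

Lemma expectation_sum_indic P (I : Type) (s : seq I) (c : I -> R)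
    (A : I -> set X) : (forall k, measurable (A k)) ->
  ('E_P[fun x => (\sum_(k <- s) c k * \1_(A k) x)%R] =
   \sum_(k <- s) (c k)%:E * P (A k))%E.
Proof.
move=> mA; rewrite unlock.
under eq_integral do rewrite -sumEFin.
have intA k : P.-integrable setT (fun x => (\1_(A k) x)%:E).
  exact: integrable_indic.
rewrite integral_sum//; last first.
  by move=> k; under eq_fun do rewrite EFinM; exact: integrableZl.
apply: eq_bigr => k _; under eq_integral do rewrite EFinM.
by rewrite integralZl// integral_indic// setIT.
Qed.

(** Lets a point probability of N be written as a difference of tails, also on
an event B. *)
Lemma prob_level_setI P (N : X -> nat) (B : set X) j :
  (forall k, measurable [set x | (k <= N x)%N]) -> measurable B ->
  fine (P ([set x | N x = j] `&` B)) =
  fine (P ([set x | (j <= N x)%N] `&` B)) -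
  fine (P ([set x | (j.+1 <= N x)%N] `&` B)).
Proof.
move=> mN mB.
have levelE : [set x | N x = j] =
    [set x | (j <= N x)%N] `\` [set x | (j.+1 <= N x)%N].
  apply/seteqP; split => x /=; first by move=> <-; rewrite ltnn leqnn.
  by move=> [jN /negP]; rewrite -leqNgt => Nj; apply/eqP; rewrite eqn_leq Nj.
have mj : measurable [set x | N x = j] by rewrite levelE; exact: measurableD.
rewrite (_ : [set x | (j <= N x)%N] `&` B =
    ([set x | N x = j] `&` B) `|` ([set x | (j.+1 <= N x)%N] `&` B)); last first.
  rewrite -setIUl; congr (_ `&` _); apply/seteqP; split => x /=.
    by rewrite leq_eqVlt => /predU1P[->|]; [left|right].
  by move=> [->//|/ltnW].
rewrite measureU; [|exact: measurableI..|].
  by rewrite fineD ?fin_num_measure//; [rewrite addrK|exact: measurableI..].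
rewrite -subset0 => x /= [[<- _] []]; by rewrite ltnn.
Qed.

(** Change of variables through the common law of f and g; integrability is
transported along with the value. *)
Lemma same_law_integral P Q n (f g : X -> n.-tuple R) (h : n.-tuple R -> R) :
  measurable_fun setT f -> measurable_fun setT g -> measurable_fun setT h ->
  (forall A, measurable A -> P (f @^-1` A) = Q (g @^-1` A)) ->
  P.-integrable setT (fun x => (h (f x))%:E) ->
  Q.-integrable setT (fun x => (h (g x))%:E) /\
  (\int[P]_x (h (f x))%:E = \int[Q]_x (h (g x))%:E)%E.
Proof.
move=> mf mg mh fg intf.
pose F : {mfun X >-> n.-tuple R} := HB.pack f (isMeasurableFun.Build _ _ _ _ f mf).
pose G : {mfun X >-> n.-tuple R} := HB.pack g (isMeasurableFun.Build _ _ _ _ g mg).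
pose h' := EFin \o h.
have mh' : measurable_fun setT h' by exact/measurable_EFinP.
have intg : Q.-integrable setT (h' \o g).
  apply/integrableP; split; first exact: measurableT_comp.
  have mh'' : measurable_fun setT (abse \o h') by exact: measurableT_comp.
  have /integrableP[_] := intf.
  rewrite -(ge0_integral_distribution (P := P) F mh'' (fun y => abse_ge0 (h' y))).
  rewrite -(ge0_integral_distribution (P := Q) G mh'' (fun y => abse_ge0 (h' y))).
  rewrite (eq_measure_integral (distribution Q G))// => A mA _; exact: fg.
split=> //.
rewrite -(@integral_distribution _ _ _ _ _ P F h')//.
rewrite -(@integral_distribution _ _ _ _ _ Q G h')//.
by apply: eq_measure_integral => A mA _; exact: fg.
Qed.

End integrals.

(** * The step-up index *)

Section step_up.
Context {R : realType} (n : nat) (rho : R -> R).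
Implicit Types u : n.-tuple R.

Lemma alpha_le j k : critical_value_function rho -> (j <= k <= n)%N ->
  alpha rho n j <= alpha rho n k.
Proof.
case=> _ rho_mono _ _ _ /andP[jk kn]; rewrite /alpha.
have [n0|n0] := posnP n; first by rewrite n0 invr0 !mulr0.
have itv m : (m <= n)%N -> m%:R / n%:R \in `[(0:R), 1].
  by move=> mn; rewrite in_itv/= divr_ge0//= ler_pdivrMr ?ltr0n// mul1r ler_nat.
apply: rho_mono; [exact: itv (leq_trans jk kn)|exact: itv|].
by rewrite ler_pM2r ?invr_gt0 ?ltr0n// ler_nat.
Qed.

Definition count_le t u : nat := #|[pred k : 'I_n | tnth u k <= t]|.

(** The step-up index as a function of the p-values that mentions no order
statistics: p_(j:n) <= alpha_j says that at least j of the p-values are at most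
alpha_j.  In this form symmetry and measurability are visible. *)
Definition step_up_count u : nat :=
  \max_(j < n.+1 | (0 < j)%N && (j <= count_le (alpha rho n j) u)%N) j.

Lemma leq_step_up_count j u : (0 < j)%N ->
  (j <= step_up_count u)%N =
  [exists k : 'I_n.+1, (j <= k)%N && (k <= count_le (alpha rho n k) u)%N].
Proof.
move=> j0; apply/idP/existsP => [|[k /andP[jk kc]]]; last first.
  by apply: (leq_trans jk); apply: leq_bigmax_cond; rewrite kc (leq_trans j0).
apply: contraTP => nok; rewrite -ltnNge -(prednK j0) ltnS.
apply/bigmax_leqP => k /andP[k0 kc]; rewrite -ltnS prednK// ltnNge.
by apply/negP => jk; apply: nok; exists k; rewrite jk.
Qed.

Lemma count_le_permute t s u : count_le t (permute s u) = count_le t u.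
Proof.
rewrite /count_le -!sum1_card [RHS](reindex_inj (@perm_inj _ s))/=.
by apply: eq_bigl => k; rewrite !inE tnth_mktuple.
Qed.

Lemma step_up_count_permute s u : step_up_count (permute s u) = step_up_count u.
Proof. by apply: eq_bigl => j; rewrite count_le_permute. Qed.

(** If p_i <= alpha_j, then p_i is counted at every level k >= j, and so is 0:
replacing p_i by 0 changes no count that matters for the event of at least k
rejections. *)
Lemma step_up_count_zero (i : 'I_n) j k u : critical_value_function rho ->
  (0 < j <= k)%N -> (j <= n)%N -> tnth u i <= alpha rho n j ->
  (k <= step_up_count (zero_outside (~` [set val i]) u))%N = (k <= step_up_count u)%N.
Proof.
move=> rho_cvf /andP[j0 jk] jn uij.
rewrite !leq_step_up_count ?(leq_trans j0 jk)//.
apply: eq_existsb => l; case: (leqP k l) => //= kl; congr (_ <= _)%N.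
have ln : (l <= n)%N by rewrite -ltnS.
have jl : alpha rho n j <= alpha rho n l.
  by apply: alpha_le => //; rewrite ln (leq_trans jk kl).
have l0 : 0 <= alpha rho n l.
  apply: le_trans (_ : alpha rho n 0 <= _); last exact: alpha_le.
  by rewrite /alpha mul0r; case: rho_cvf => _ _ _ [-> _] _.
apply: eq_card => m; rewrite !inE tnth_mktuple; case: asboolP => // /contrapT.
by move=> /= /ord_inj ->; rewrite l0 (le_trans uij).
Qed.

Lemma measurable_leq_step_up_count j :
  measurable [set u | (j <= step_up_count u)%N].
Proof.
have mcount t k : measurable [set u | (k <= count_le t u)%N].
  pose f u : n.-tuple bool := [tuple tnth u l <= t | l < n].
  have mf : measurable_fun setT f.
    apply/measurable_fun_tnthP => l; rewrite /comp/=.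
    under eq_fun do rewrite tnth_mktuple.
    by apply: measurable_fun_ler => //; exact: measurable_tnth.
  have fE u : #|[pred l | tnth (f u) l]| = count_le t u.
    by apply: eq_card => l; rewrite !inE tnth_mktuple.
  rewrite (_ : [set u | _] = f @^-1` [set b | (k <= #|[pred l | tnth b l]|)%N]).
    by rewrite -[X in measurable X]setTI; apply: mf => //;
      exact: measurable_tuple_bool.
  by apply/seteqP; split => u /=; rewrite fE.
have [->|j0] := posnP j; first by rewrite (_ : [set u | _] = setT)//; apply/seteqP.
rewrite (_ : [set u | _] = \bigcup_(k in [set k : 'I_n.+1 | (j <= k)%N])
    [set u | (k <= count_le (alpha rho n k) u)%N]).
  by apply: fin_bigcup_measurable => [|k _]; [exact: finite_finset|exact: mcount].
apply/seteqP; split => u /=; rewrite leq_step_up_count//.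
  by move=> /existsP[k /andP[jk kc]]; exists k.
by move=> [k jk kc]; apply/existsP; exists k; rewrite jk.
Qed.

(** The entries at most t form an initial segment of the sorted sequence. *)
Lemma nth_sort_le (s : seq R) t j : (0 < j <= size s)%N ->
  (nth 0 (sort <=%R s) j.-1 <= t) = (j <= count (fun v => v <= t)%R s)%N.
Proof.
case: j => // j /= js; rewrite -(count_sort <=%R).
have ss : sorted <=%R (sort <=%R s) by apply: sort_sorted; exact: le_total.
have [jc|cj] := ltnP j (count _ _); first exact: nth_count_le.
apply/negbTE; rewrite -ltNge; apply: nth_count_gt => //.
by rewrite cj size_sort.
Qed.

Lemma step_up_index_count (d : measure_display) (X : measurableType d)
    (p : nat -> {mfun X >-> R}) (x : X) :
  step_up_index p n rho x = step_up_count (pvec p n x).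
Proof.
apply: eq_bigl => j; case: (posnP j) => //= j0.
rewrite /ordered_pvalue nth_sort_le; last by rewrite size_tuple j0 -ltnS ltn_ord.
congr (_ <= _)%N; rewrite /count_le -sum1_count -sum1_card big_tuple.
by apply: eq_bigl => k; rewrite inE.
Qed.
End step_up.

(** * The false discovery rate *)

Section fdr.
Context {d : measure_display} {X : measurableType d} {R : realType}.
Context {Theta : Type}.
Variables (P : Theta -> probability X R) (H : nat -> set Theta).
Variable p : nat -> {mfun X >-> R}.
Variable Pz : Theta -> nat -> probability X R.
Variables (n : nat) (phi : {mfun n.-tuple R >-> n.-tuple bool}) (rho : R -> R).
Variable theta : Theta.

Local Notation J := (I0 H theta).
Local Notation pv := (pvec p n).
Local Notation N := (Rn p phi).
Local Notation a := (alpha rho n).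
Local Notation frac j := (j%:R / n%:R : R).

Hypothesis rho_cvf : critical_value_function rho.
Hypothesis p01 : forall i x, p i x \in `[0, 1].
Hypothesis Pz_zeroed : forall i, J i -> zeroed_law (Pz theta i) (P theta) p i.
Hypothesis indJ : mutually_independent (P theta) p (In0 H n theta).
Hypothesis unifJ : forall i, In0 H n theta i -> uniform01 (P theta) (p i).
Hypothesis indJC :
  independent_vectors (P theta) p (In0 H n theta) (In1 H n theta).

Definition rejections (b : n.-tuple bool) : nat := #|[pred i | tnth b i]|.

Lemma Rn_le x : (N x <= n)%N.
Proof. by rewrite -[leqRHS]card_ord max_card. Qed.

Lemma measurable_test (A : set (n.-tuple bool)) :
  measurable [set u | A (phi u)].
Proof.
rewrite -[X in measurable X]setTI.
by apply: (measurable_funPT phi) => //; exact: measurable_tuple_bool.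
Qed.

Lemma measurable_Rn (A : set nat) : measurable [set x | A (N x)].
Proof.
rewrite -[X in measurable X]setTI.
exact: (@measurable_pvec _ _ _ p n measurableT _
  (measurable_test [set b | A (rejections b)])).
Qed.

Lemma measurable_pvalue_le i t : measurable [set x | p i x <= t].
Proof.
rewrite (_ : [set x | _] = p i @^-1` `]-oo, t]).
  by rewrite -[X in measurable X]setTI; exact: measurable_funPT.
by apply/seteqP; split => x /=; rewrite in_itv.
Qed.

(** For given x only j = N x contributes to the inner sum, and then T2
identifies the event p_i <= alpha_j with the rejection of i. *)
Lemma fdp_sum x : T2 p phi rho ->
  (Vn H p phi theta x)%:R / (maxn (N x) 1)%:R =
  \sum_(i < n | `[< J i >]) \sum_(1 <= j < n.+1)
     j%:R^-1 * \1_([set x | N x = j] `&` [set x | p i x <= a j]) x :> R.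
Proof.
move=> HT2; transitivity (\sum_(i < n | `[< J i >])
    (rejected p phi x i)%:R / (maxn (N x) 1)%:R :> R).
  rewrite -mulr_suml -natr_sum /Vn -sum1_card; congr (_%:R / _).
  rewrite [in RHS]big_mkcond [in LHS]big_mkcond; apply: eq_bigr => i _.
  rewrite inE andbC -[`[< J i >]]/(`[< H i theta >]).
  by case: `[< _ >] => //=; case: rejected.
apply: eq_bigr => i _; have [N0|Npos] := posnP (N x).
  have -> : rejected p phi x i = false.
    by apply: contraPF N0 => ri; apply/eqP; rewrite -lt0n; apply/card_gt0P; exists i.
  rewrite mul0r big_nat big1// => j /andP[j1 _].
  rewrite indicE memNset ?mulr0//= => -[Nj _].
  by rewrite -Nj N0 in j1.
rewrite (bigD1_seq (N x)) ?iota_uniq ?mem_index_iota ?Npos ?ltnS ?Rn_le//=.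
rewrite big1 ?addr0; last first.
  by move=> j jN; rewrite indicE memNset ?mulr0//= => -[Nj _]; rewrite Nj eqxx in jN.
rewrite (maxn_idPl Npos) mulrC; congr (_ * _).
have NH : rejected p phi x i <-> p i x <= a (N x).
  by apply: HT2 => //; rewrite Npos Rn_le.
rewrite indicE; case: (boolP (rejected _ _ _ _)) => ri.
  by rewrite mem_set//=; split => //; apply/NH.
by rewrite memNset//= => -[_ /NH]; apply/negP.
Qed.

Lemma FDR_sum : T2 p phi rho ->
  FDR P H p phi theta =
  (\sum_(i < n | `[< J i >]) \sum_(1 <= j < n.+1) (j%:R^-1)%:E *
     P theta ([set x | N x = j] `&` [set x | (p i x <= a j)%R]))%E.
Proof.
move=> HT2; rewrite /FDR.
rewrite (_ : (fun x => _) = fun x => \sum_(ij <- [seq (i, j) |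
      i <- [seq i <- index_enum 'I_n | `[< J (i : 'I_n) >]],
      j <- index_iota 1 n.+1]) ij.2%:R^-1 *
      \1_([set x | N x = ij.2] `&` [set x | p ij.1 x <= a ij.2]) x).
  rewrite expectation_sum_indic ?big_allpairs ?big_filter// => ij.
  by apply: measurableI;
    [exact: (measurable_Rn [set m | m = ij.2])|exact: measurable_pvalue_le].
by apply/funext => x; rewrite big_allpairs big_filter fdp_sum.
Qed.

Lemma frac_gt0 j : (1 <= j <= n)%N -> 0 < frac j <= 1.
Proof.
move=> /andP[j1 jn]; have n0 := leq_trans j1 jn.
by rewrite divr_gt0 ?ltr0n//= ler_pdivrMr ?ltr0n// mul1r ler_nat.
Qed.

Lemma alpha_gt0 j : (1 <= j <= n)%N -> 0 < a j <= 1.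
Proof.
move=> /frac_gt0 /andP[f0 f1].
case: rho_cvf => _ _ rho01 [_ rho_gt0] _; rewrite /alpha rho_gt0 ?in_itv/= ?f0//.
have : rho (frac j) \in `[0, 1] by apply: rho01; rewrite in_itv/= ltW.
by rewrite in_itv/= => /andP[].
Qed.

Lemma prob_pvalue_le i j : In0 H n theta i -> (1 <= j <= n)%N ->
  P theta [set x | p i x <= a j] = (a j)%:E.
Proof.
move=> Ji /alpha_gt0/andP[a0 a1]; rewrite -uniform_prob_le ?(ltW a0)//.
by rewrite -(unifJ Ji).
Qed.

(** Uniformity of the true p-values gives P (p_i <= alpha_j) = alpha_j, and
1/j = q (j/n) / (n alpha_j) by the definition of q. *)
Lemma FDR_cprob : T2 p phi rho ->
  FDR P H p phi theta = (n%:R^-1 *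
    \sum_(i < n | `[< J i >]) \sum_(1 <= j < n.+1) q rho (frac j) *
     cprob (P theta) [set x | N x = j] [set x | p i x <= a j])%:E.
Proof.
move=> HT2; rewrite FDR_sum// mulr_sumr -sumEFin; apply: eq_bigr => i /asboolP Ji.
rewrite mulr_sumr -sumEFin !big_nat; apply: eq_bigr => j /andP[j1 jn].
have jn' : (1 <= j <= n)%N by rewrite j1.
rewrite /cprob prob_pvalue_le//; last by split => //=.
have mA : measurable ([set x | N x = j] `&` [set x | p i x <= a j]).
  by apply: measurableI;
    [exact: (measurable_Rn [set m | m = j])|exact: measurable_pvalue_le].
have /andP[a0 _] := alpha_gt0 jn'; have /andP[f0 _] := frac_gt0 jn'.
rewrite -[X in (_ * X)%E](fineK) ?fin_num_measure// -EFinM; congr EFin.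
rewrite /q gt_eqF// -/(a j) /=.
have j0 : j%:R != 0 :> R by rewrite pnatr_eq0 -lt0n.
have n0 : n%:R != 0 :> R by rewrite pnatr_eq0 -lt0n (leq_trans j1).
by field; rewrite j0 n0 gt_eqF.
Qed.

Lemma cprob_level i j t :
  cprob (P theta) [set x | N x = j] [set x | p i x <= t] =
  cprob (P theta) [set x | (j <= N x)%N] [set x | p i x <= t] -
  cprob (P theta) [set x | (j.+1 <= N x)%N] [set x | p i x <= t].
Proof.
rewrite /cprob prob_level_setI ?mulrBl//; last exact: measurable_pvalue_le.
by move=> k; exact: (measurable_Rn [set m | (k <= m)%N]).
Qed.

Lemma prob_level (Q : probability X R) j :
  fine (Q [set x | N x = j]) =
  fine (Q [set x | (j <= N x)%N]) - fine (Q [set x | (j.+1 <= N x)%N]).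
Proof.
have := @prob_level_setI _ _ _ Q N setT j; rewrite !setIT; apply => // k.
exact: (measurable_Rn [set m | (k <= m)%N]).
Qed.

(** Summation by parts, with a_j and c_j the conditional probabilities of N >= j
and N >= j + 1 given p_i <= alpha_j, and b_j the probability of N >= j when
p_i is set to 0.  D1 gives a_(j+1) <= c_j and D2 gives a_j <= b_j. *)
Lemma weighted_cprob_le i : D1 P H p phi rho -> D2 P H p Pz phi rho ->
  In0 H n theta i ->
  \sum_(1 <= j < n.+1) q rho (frac j) *
     cprob (P theta) [set x | N x = j] [set x | p i x <= a j] <=
  \sum_(1 <= j < n.+1) qbar rho (frac j) *
     fine (Pz theta i [set x | N x = j]).
Proof.
move=> HD1 HD2 Ji.
apply: (@le_trans _ _ (\sum_(1 <= j < n.+1) qbar rho (frac j) *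
     cprob (P theta) [set x | N x = j] [set x | p i x <= a j])).
  rewrite !big_nat; apply: ler_sum => j jn; apply: ler_wpM2r.
    by rewrite /cprob divr_ge0// fine_ge0.
  have /andP[f0 f1] := frac_gt0 jn.
  by apply: ratio_le_qbar => //; rewrite lexx ltW.
under eq_big_nat => j _ do rewrite cprob_level.
under [leRHS]eq_big_nat => j _ do rewrite prob_level.
have itv j : (1 <= j <= n)%N -> a j \in `]0, a j].
  by move=> /alpha_gt0/andP[a0 _]; rewrite in_itv/= a0 lexx.
apply: (sum_by_parts_le
  (a := fun j => cprob (P theta) [set x | (j <= N x)%N] [set x | p i x <= a j])
  (b := fun j => fine (Pz theta i [set x | (j <= N x)%N]))
  (c := fun j => cprob (P theta) [set x | (j.+1 <= N x)%N] [set x | p i x <= a j])).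
- move=> j jn; have /andP[f0 f1] := frac_gt0 jn.
  apply: (@le_trans _ _ (q rho (frac j))); first by rewrite ltW// ratio_gt0// f0.
  by apply: ratio_le_qbar => //; rewrite lexx ltW.
- move=> j /andP[j1 jn]; have /andP[f0 f1] := @frac_gt0 j.+1 jn.
  apply: qbar_nondecreasing => //; rewrite divr_ge0//=.
  by rewrite ler_pM2r ?invr_gt0 ?ltr0n ?ler_nat// (leq_trans _ jn).
- move=> j jn; rewrite -lee_fin fineK; first exact: HD2 (itv _ jn).
  by apply: fin_num_measure; exact: (measurable_Rn [set m | (j <= m)%N]).
- move=> j /andP[j1 jn].
  have jn' : (1 <= j <= n)%N by rewrite j1 ltnW.
  have aj : a j <= a j.+1 by apply: alpha_le; rewrite // leqnSn.
  apply: (HD1 theta j.+1 i) => //; first exact: itv.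
  by rewrite in_itv/= aj andbT; case/andP: (alpha_gt0 jn').
- rewrite (_ : [set x | _] = set0); last first.
    by rewrite -subset0 => x /=; rewrite ltnNge (leq_trans (Rn_le x)).
  by rewrite measure0 /cprob divr_ge0// fine_ge0.
Qed.

(** Setting p_i to 0 amounts to exchanging p_i and p_j, setting p_j to 0 and
exchanging back.  The first exchange leaves the law unchanged, the last one
leaves A unchanged. *)
Lemma Pz_symmetric (i j : 'I_n) (A : set (n.-tuple R)) : J i -> J j ->
  measurable A ->
  (forall s u, (forall k, tnth u k \in `[0, 1]) -> A (permute s u) <-> A u) ->
  Pz theta i (pv @^-1` A) = Pz theta j (pv @^-1` A).
Proof.
move=> Ji Jj mA symA; set s := tperm i j.
pose zj := zero_outside (R := R) (n := n) (~` [set val j]).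
rewrite !(zeroed_law_pvec (Pz_zeroed _))//.
rewrite -[RHS]/(P theta (pv @^-1` (zj @^-1` A))).
rewrite -(prob_pvec_tperm indJ unifJ indJC Ji Jj); last first.
  by rewrite -[X in measurable X]setTI; exact: measurable_zero_outside.
have cube x k : tnth (zj (permute s (pv x))) k \in `[0, 1].
  by rewrite !tnth_mktuple; case: asbool; rewrite ?p01// in_itv/= lexx ler01.
have zE x : zero_outside (~` [set val i]) (pv x) =
    permute s (zj (permute s (pv x))).
  apply: eq_from_tnth => k; rewrite !tnth_mktuple tpermK.
  congr (if _ then _ else _); apply: asbool_equiv_eq; rewrite /=.
  have -> : ((s k : nat) = j) = ((k : nat) = i).
    apply/propext; rewrite /s; split => [/ord_inj|/ord_inj ->];
      last by rewrite tpermL.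
    by move/(canRL (tpermK _ _)); rewrite tpermR => ->.
  by [].
congr (P theta _); apply/seteqP; split => x; rewrite /preimage/= zE.
  by move/(symA _ _ (cube x)).
by move=> Ax; apply/(symA _ _ (cube x)).
Qed.

Lemma Pz_rejections_symmetric (i j : 'I_n) (A : set nat) : J i -> J j ->
  permutation_equivariant phi ->
  Pz theta i [set x | A (N x)] = Pz theta j [set x | A (N x)].
Proof.
move=> Ji Jj equi.
apply: (Pz_symmetric (A := [set u | A (rejections (phi u))])) => //.
  exact: (measurable_test [set b | A (rejections b)]).
move=> s u u01 /=;
  suff -> : rejections (phi (permute s u)) = rejections (phi u) by [].
rewrite /rejections -!sum1_card [RHS](reindex_inj (@perm_inj _ s))/=.
by apply: eq_bigl => k; rewrite !inE equi.
Qed.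

Lemma sum_over_true (w : 'I_n -> R) (b : R) :
  (forall i : 'I_n, J i -> w i = b) ->
  \sum_(i < n | `[< J i >]) w i =
  #|[pred i : 'I_n | `[< In0 H n theta i >]]|%:R * b.
Proof.
move=> wb; rewrite (eq_bigr (fun=> b)); last by move=> i /asboolP /wb.
rewrite sumr_const mulr_natl; congr (_ *+ _); apply: eq_card => i.
rewrite !inE; apply/asboolP/asboolP => [Ji|[]//].
by split => //=.
Qed.

Section reference_hypothesis.
Variable i0 : 'I_n.
Hypothesis Ji0 : J i0.

Local Notation n0 := #|[pred i : 'I_n | `[< In0 H n theta i >]]|.
Local Notation c := (n0%:R / n%:R : R).
Local Notation bound := (c * \sum_(1 <= j < n.+1) qbar rho (frac j) *
  fine (Pz theta i0 [set x | N x = j])).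

Lemma FDR_le_bound : T2 p phi rho -> D1 P H p phi rho -> D2 P H p Pz phi rho ->
  permutation_equivariant phi ->
  (FDR P H p phi theta <= bound%:E)%E.
Proof.
move=> HT2 HD1 HD2 equi; rewrite FDR_cprob// lee_fin mulrAC mulrC.
rewrite ler_wpM2r ?invr_ge0//.
rewrite -(@sum_over_true (fun=> \sum_(1 <= j < n.+1) qbar rho (frac j) *
  fine (Pz theta i0 [set x | N x = j]))) //.
apply: ler_sum => i /asboolP Ji.
apply: le_trans (weighted_cprob_le HD1 HD2 (i := i) _) _; first by split => //=.
apply: ler_sum => j _.
by rewrite (Pz_rejections_symmetric [set m | m = j] Ji Ji0).
Qed.

(** The step-up index m is the number of p-values at most alpha_m: were this
number larger than m, it would itself qualify as an index. *)
Lemma Rn_step_up x : is_step_up p phi rho ->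
  N x = step_up_count rho (pv x).
Proof.
move=> su; set m := step_up_count rho (pv x).
have rejE (i : 'I_n) : rejected p phi x i <-> (0 < m)%N /\ p i x <= a m.
  by have := su x i; rewrite step_up_index_count.
have [m0|mpos] := posnP m.
  rewrite m0; apply: eq_card0 => i; rewrite inE; apply/negbTE/negP => /rejE.
  by rewrite m0 => -[].
have NE t : t = a m -> N x = count_le t (pv x).
  move=> ->; apply: eq_card => i; rewrite !inE tnth_mktuple.
  by apply/idP/idP => [/rejE[]//|pa]; apply/rejE.
have mn : (m <= n)%N by apply/bigmax_leqP => k _; rewrite -ltnS.
have mle : (m <= N x)%N.
  have : (m <= m)%N := leqnn m; rewrite {2}/m leq_step_up_count//.
  move=> /existsP[k /andP[mk kc]].
  have km : k = m :> nat.
    apply/eqP; rewrite eqn_leq mk andbT.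
    by rewrite /m leq_step_up_count ?(leq_trans mpos)//; apply/existsP;
      exists k; rewrite leqnn.
  by rewrite km in kc; rewrite (NE (a m)).
apply/eqP; rewrite eqn_leq mle andbT /m leq_step_up_count ?(leq_trans mpos)//.
apply/existsP; exists (inord (N x)); rewrite inordK ?ltnS ?Rn_le// leqnn/=.
rewrite {1}(NE (a m))//; apply: subset_leq_card; apply/fintype.subsetP => i.
rewrite !inE => /le_trans; apply; apply: alpha_le => //.
by rewrite mle Rn_le.
Qed.

(** Given p_i <= alpha_j, the tails of N from j on are determined by the
p-values with p_i set to 0, which are independent of p_i: the conditioning
drops out.  The point probability is a difference of two such tails. *)
Lemma step_up_cprob (i : 'I_n) j : is_step_up p phi rho -> J i ->
  (1 <= j <= n)%N ->
  cprob (P theta) [set x | N x = j] [set x | p i x <= a j] =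
  fine (Pz theta i [set x | N x = j]).
Proof.
move=> su Ji jn; have [/andP[j1 jn'] /andP[a0 _]] := (jn, alpha_gt0 jn).
have levelE k : [set x | (k <= N x)%N] =
    pv @^-1` [set u | (k <= step_up_count rho u)%N].
  by apply/seteqP; split => x /=; rewrite Rn_step_up.
suff tailE k : (j <= k)%N ->
    cprob (P theta) [set x | (k <= N x)%N] [set x | p i x <= a j] =
    fine (Pz theta i [set x | (k <= N x)%N]).
  by rewrite cprob_level prob_level !tailE.
move=> jk; rewrite !levelE (zeroed_law_pvec (Pz_zeroed Ji)); last first.
  exact: measurable_leq_step_up_count.
rewrite /cprob prob_pvalue_le//; last by split => //=.
set A := [set u | _]; set B := [set x | _ <= _].
have -> : pv @^-1` A `&` B =
    B `&` (zero_outside (~` [set val i]) \o pv) @^-1` A.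
  rewrite setIC; apply/seteqP; split => x [Bx Ax]; split => //; move: Ax.
    by rewrite /A /= (step_up_count_zero (j := j)) ?j1// tnth_mktuple.
  by rewrite /A /= (step_up_count_zero (j := j)) ?j1// tnth_mktuple.
rewrite (_ : B = p i @^-1` `]-oo, a j]); last first.
  by apply/seteqP; split => x; rewrite /B/= in_itv.
rewrite (prob_indep_coordinate indJ unifJ indJC)//; last first.
  exact: measurable_leq_step_up_count.
rewrite (_ : p i @^-1` _ = [set x | p i x <= a j]); last first.
  by apply/seteqP; split => x; rewrite /= in_itv.
rewrite prob_pvalue_le//; last by split => //=.
rewrite fineM// ?fin_num_measure//; last first.
  apply: measurable_preimage_pvec; first exact: measurable_zero_outside.
  exact: measurable_leq_step_up_count.
by rewrite /= [X in X / _]mulrC mulfK// gt_eqF.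
Qed.

Lemma step_up_FDR : T2 p phi rho -> is_step_up p phi rho -> A2 rho ->
  FDR P H p phi theta = bound%:E.
Proof.
move=> HT2 su HA2; rewrite FDR_cprob//; congr EFin.
rewrite [RHS]mulrAC [LHS]mulrC; congr (_ * _); apply: sum_over_true => i Ji.
rewrite !big_nat; apply: eq_bigr => j jn.
rewrite step_up_cprob// qbar_A2 ?frac_gt0//; congr (_ * fine _).
rewrite (_ : [set x | N x = j] = pv @^-1` [set u | step_up_count rho u = j]).
  apply: Pz_symmetric => //.
    rewrite (_ : [set u | _] = [set u | (j <= step_up_count rho u)%N] `\`
        [set u | (j.+1 <= step_up_count rho u)%N]).
      by apply: measurableD; exact: measurable_leq_step_up_count.
    apply/seteqP; split => u /=; first by move=> ->; rewrite leqnn ltnn.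
    by move=> [ju /negP]; rewrite -leqNgt => uj; apply/eqP; rewrite eqn_leq uj.
  by move=> s u _ /=; rewrite step_up_count_permute.
by apply/seteqP; split => x /=; rewrite Rn_step_up.
Qed.

End reference_hypothesis.

Section expected_bound.
Variable i0 : 'I_n.
Hypothesis Ji0 : J i0.
Variable PU : set nat -> probability X R.
Hypothesis PU_dirac : forall I, dirac_uniform (PU I) p I.

Local Notation I' := (J `\ (i0 : nat)).

(** Under theta^(i0) the p-value p_(i0) is 0 almost surely, so that T1 forces a
rejection, and the sum over j >= 1 in the bound is the whole expectation. *)
Lemma Pz_no_rejection : T1 p phi rho -> Pz theta i0 [set x | N x = 0%N] = 0%E.
Proof.
move=> HT1; pose A : set (n.-tuple R) := [set u | tnth u i0 != 0].
have mA : measurable A.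
  rewrite (_ : A = (@tnth n R)^~ i0 @^-1` ~` [set 0]).
    rewrite -[X in measurable X]setTI; apply: measurable_tnth => //.
    exact: measurableC.
  by apply/seteqP; split => u /= /eqP.
have PzA0 : Pz theta i0 (pv @^-1` A) = 0%E.
  rewrite (zeroed_law_pvec (Pz_zeroed Ji0))// (_ : _ @^-1` A = set0) ?measure0//.
  by rewrite -subset0 => x; rewrite /A /= !tnth_mktuple asboolF ?eqxx//; exact.
apply: (subset_measure0 _ _ _ PzA0).
- exact: (measurable_Rn [set m | m = 0%N]).
- by rewrite -[X in measurable X]setTI; exact: measurable_pvec.
move=> x /= Nx0; apply/eqP; rewrite tnth_mktuple => px0.
have : (0 < N x)%N.
  apply/card_gt0P; exists i0; apply: HT1; rewrite px0.
  by case/andP: (@alpha_gt0 1 (leq_ltn_trans (leq0n _) (ltn_ord i0))) => /ltW.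
by rewrite Nx0.
Qed.

Lemma expectation_Rn (Q : probability X R) (f : nat -> R) :
  ('E_Q[fun x => f (N x)] =
   \sum_(0 <= j < n.+1) (f j)%:E * Q [set x | N x = j])%E.
Proof.
rewrite -expectation_sum_indic; last first.
  by move=> j; exact: (measurable_Rn [set m | m = j]).
congr expectation; apply/funext => x.
rewrite (bigD1_seq (N x)) ?iota_uniq ?mem_index_iota ?ltnS ?Rn_le//=.
rewrite indicE mem_set// mulr1 big1 ?addr0// => j jN.
by rewrite indicE memNset ?mulr0//= => Nj; rewrite Nj eqxx in jN.
Qed.

Lemma integrable_Rn (Q : probability X R) (f : nat -> R) :
  Q.-integrable setT (fun x => (f (N x))%:E).
Proof.
apply: measurable_bounded_integrable => //.
- by rewrite /= probability_setT ltry.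
- by move=> _ C mC; rewrite setTI; exact: (measurable_Rn (f @^-1` C)).
exists (\sum_(j < n.+1) `|f j|); split; first exact: num_real.
move=> M /ltW ltM x _ /=; apply: le_trans ltM.
have Nn : (N x < n.+1)%N by rewrite ltnS Rn_le.
by rewrite (bigD1 (Ordinal Nn))//= lerDl sumr_ge0.
Qed.

(** Under a Dirac-uniform configuration the coordinates outside I are already 0,
except on a null set W. *)
Lemma PU_pvec I A : measurable A ->
  PU I (pv @^-1` A) = PU I ((zero_outside I \o pv) @^-1` A).
Proof.
move=> mA; have [_ _ zeroI] := PU_dirac I.
have /ae_foralln[W [mW W0 subW]] : forall k, \forall x \ae PU I,
    ~ I k -> p k x = 0.
  by move=> k; have [Ik|/zeroI] := pselect (I k); [exact: aeW|apply: filterS].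
have restr B : measurable B -> PU I B = PU I (B `\` W).
  move=> mB; have BW0 : PU I (B `&` W) = 0%E.
    apply: (subset_measure0 _ mW) => //; exact: measurableI.
  by rewrite -[RHS]adde0 -BW0; exact: measureDI.
rewrite restr; last by rewrite -[X in measurable X]setTI; exact: measurable_pvec.
rewrite [RHS]restr; last first.
  by apply: measurable_preimage_pvec => //; exact: measurable_zero_outside.
congr (PU I _).
have pvE x : ~ W x -> zero_outside I (pv x) = pv x.
  move=> /(contra_not (@subW x))/contrapT pI0; apply: eq_from_tnth => k.
  by rewrite !tnth_mktuple; case: asboolP => // /pI0.
by apply/seteqP; split => x /= [Ax Wx]; split => //; move: Ax; rewrite pvE.
Qed.

(** Both vectors are distributed like functions of the p-values under theta:
one sets to 0 all coordinates outside I', the other one only coordinate i0,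
and so the first is below the second pointwise. *)
Lemma dirac_stoch_le :
  stoch_le (@tuple_le n R <=%R) (PU I') (Pz theta i0) pv.
Proof.
move=> f mf fmono int1 int2; rewrite unlock.
have [indU unifU _] := PU_dirac I'.
have mz K : measurable_fun setT (zero_outside K \o pv).
  by apply: measurableT_comp;
    [exact: measurable_zero_outside|exact: measurable_pvec].
have subI : I' `&` [set k | (k < n)%N] `<=` In0 H n theta.
  by move=> k [[Jk _] kn]; split.
have mpv : measurable_fun setT pv by exact: measurable_pvec.
have lawU A : measurable A ->
    PU I' (pv @^-1` A) = P theta ((zero_outside I' \o pv) @^-1` A).
  move=> mA; rewrite PU_pvec//; apply: prob_zero_outside_indep => //.
  - exact: mutually_independentS indU.
  - by move=> k [Ik _]; exact: unifU.
  - exact: mutually_independentS indJ.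
  - by move=> k Ik; apply: unifJ; exact: subI.
have [int1' ->] := same_law_integral mpv (mz I') mf lawU int1.
have [int2' ->] := same_law_integral mpv (mz (~` [set val i0])) mf
  (fun A => zeroed_law_pvec (Pz_zeroed Ji0)) int2.
apply: le_integral => // x _; rewrite lee_fin; apply: fmono.
apply/forallP => k; rewrite !tnth_mktuple.
case: asboolP => [[Jk ki]|_]; first by rewrite asboolT.
by case: ifP => // _; have := p01 k x; rewrite in_itv/= => /andP[].
Qed.

Lemma expectation_qbar_le : A1 P H p Pz PU phi ->
  ('E_(Pz theta i0)[fun x => qbar rho ((N x)%:R / n%:R)%R] <=
   'E_(PU I')[fun x => qbar rho ((N x)%:R / n%:R)%R])%E.
Proof.
move=> HA1; pose f (b : n.-tuple bool) := qbar rho (frac (rejections b)).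
have rej_le b : (rejections b <= n)%N by rewrite -[leqRHS]card_ord max_card.
have n_gt0 : (0 < n)%N by rewrite (leq_ltn_trans _ (ltn_ord i0)).
have fracS j k : (j <= k <= n)%N -> qbar rho (frac j) <= qbar rho (frac k).
  move=> /andP[jk kn]; apply: qbar_nondecreasing => //.
    by rewrite divr_ge0//= ler_pM2r ?invr_gt0 ?ltr0n// ler_nat.
  by rewrite ler_pdivrMr ?ltr0n// mul1r ler_nat.
have mf : measurable_fun setT f by move=> _ C mC; exact: measurable_tuple_bool.
have intf Q := integrable_Rn Q (fun j => qbar rho (frac j)).
apply: (HA1 _ _ _ _ dirac_stoch_le f mf _ (intf _) (intf _)).
- by apply: Or33; exists I'.
- by apply: Or32; exists theta, (i0 : nat).
move=> b b' /forallP bb'; apply: fracS; rewrite rej_le andbT.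
apply: subset_leq_card; apply/fintype.subsetP => k; rewrite !inE.
by have /implyP := bb' k.
Qed.

End expected_bound.
End fdr.

Theorem theorem4p3
  (R : realType) (d : measure_display) (X : measurableType d)
  (Theta : Type) (P : Theta -> probability X R)
  (H : nat -> set Theta) (H_neq0 : forall i, H i !=set0)
  (p : nat -> {mfun X >-> R}) (p_pvalues : is_pvalues P H p)
  (PU : set nat -> probability X R)
  (PU_dirac_uniform : forall I : set nat, dirac_uniform (PU I) p I)
  (Pz : Theta -> nat -> probability X R)
  (Pz_zeroed : forall theta i, I0 H theta i ->
     zeroed_law (Pz theta i) (P theta) p i)
  (rho : R -> R) (rho_critical : critical_value_function rho)
  (n : nat) (phi : {mfun n.-tuple R >-> n.-tuple bool})
  (theta : Theta) (n0 : nat) (n0_bounds : (1 <= n0 <= n)%N)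
  (n0_card : #|[pred i : 'I_n | `[< In0 H n theta i >]]| = n0)
  (i0 : nat) (i0_mem : I0 H theta i0)
  (i0_min : forall i, I0 H theta i -> (i0 <= i)%N)
  (HT1 : T1 p phi rho) (HT2 : T2 p phi rho)
  (HD1 : D1 P H p phi rho) (HD2 : D2 P H p Pz phi rho) (HD3 : D3 P H p n)
  (HI1 : Ind1 P H p n) (HI2 : Ind2 P H p n) :
  let c : \bar R := (n0%:R / n%:R)%:E in
  let rejection_rate x : R := (Rn p phi x)%:R / n%:R in
  let bound : \bar R := (c * \sum_(1 <= j < n.+1)
     (qbar rho (j%:R / n%:R)%R)%:E
     * Pz theta i0 [set x | rejection_rate x = (j%:R / n%:R)%R])%E in
  [/\ permutation_equivariant phi -> (FDR P H p phi theta <= bound)%E,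
      bound = (c * 'E_(Pz theta i0)[fun x => qbar rho (rejection_rate x)])%E,
      is_step_up p phi rho -> A2 rho -> FDR P H p phi theta = bound &
      permutation_equivariant phi -> A1 P H p Pz PU phi ->
      (FDR P H p phi theta
       <= c * 'E_(PU (I0 H theta `\ i0))[fun x => qbar rho (rejection_rate x)])%E].
Proof.
move=> c rejection_rate bound.
have [p01 _] := p_pvalues.
have [i [Ji ilt]] : exists i, In0 H n theta i.
  have : (0 < #|[pred i : 'I_n | `[< In0 H n theta i >]]|)%N.
    by rewrite n0_card; case/andP: n0_bounds.
  by case/card_gt0P => i; rewrite inE => Ji; exists i.
have i0n : (i0 < n)%N by apply: leq_ltn_trans ilt; exact: i0_min.
pose k0 := Ordinal i0n.
have n_gt0 : (0 < n)%N by rewrite (leq_ltn_trans _ i0n).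
have [indJ _] := HI1 theta; have indJC := HI2 theta.
have zeroed k : I0 H theta k -> zeroed_law (Pz theta k) (P theta) p k.
  exact: Pz_zeroed.
have rateE j : [set x | rejection_rate x = j%:R / n%:R] =
    [set x | Rn p phi x = j].
  apply/seteqP; split => x /= => [/mulIf|<-//].
  rewrite invr_eq0 pnatr_eq0 -lt0n n_gt0 => /(_ isT)/eqP.
  by rewrite eqr_nat => /eqP.
have boundE : bound = (n0%:R / n%:R * \sum_(1 <= j < n.+1)
    qbar rho (j%:R / n%:R) * fine (Pz theta k0 [set x | Rn p phi x = j]))%:E.
  rewrite /bound EFinM -sumEFin; congr (_ * _)%E; apply: eq_bigr => j _.
  rewrite rateE EFinM fineK// fin_num_measure//.
  exact: (measurable_Rn p phi [set m | m = j]).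
have bound_expectation :
    bound = (c * 'E_(Pz theta i0)[fun x => qbar rho (rejection_rate x)])%E.
  rewrite (expectation_Rn p phi _ (fun j => qbar rho (j%:R / n%:R))).
  rewrite big_ltn// (Pz_no_rejection rho_critical zeroed (i0 := k0))//.
  rewrite mule0 add0e /bound; congr (_ * _)%E; apply: eq_bigr => j _.
  by rewrite rateE.
have FDR_le : permutation_equivariant phi -> (FDR P H p phi theta <= bound)%E.
  move=> equi; rewrite boundE -n0_card.
  exact: (FDR_le_bound rho_critical p01 zeroed indJ (@HD3 theta) indJC
    (i0 := k0)).
split => //.
- move=> su HA2; rewrite boundE -n0_card.
  exact: (step_up_FDR rho_critical p01 zeroed indJ (@HD3 theta) indJC
    (i0 := k0)).
- move=> equi HA1; apply: (le_trans (FDR_le equi)); rewrite bound_expectation.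
  apply: lee_wpmul2l; first by rewrite lee_fin divr_ge0.
  exact: (expectation_qbar_le rho_critical p01 zeroed indJ
    (@HD3 theta) (i0 := k0) i0_mem PU_dirac_uniform HA1).
Qed.
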